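(* For all $n\ge0$ and all $k\ge1$ we have $$|I_n(3412,\ 4231,\ k+2\ k+1\ \ldots\ 4\,3\,2\,1)|=F_{k+1,n+1}.$$
   Context: $I_n(\sigma_1,\sigma_2,\ldots)$ is the set of involutions of $\{1,\ldots,n\}$ (in one-line notation) which avoid each pattern $\sigma_i$, i.e. have no subsequence in the same relative order as $\sigma_i$. The pattern $k+2\ k+1\ \ldots\ 4\,3\,2\,1$ is the decreasing permutation of length $k+2$. $F_{k,n}$ is the $k$-generalized Fibonacci number, defined by $F_{k,n}=0$ for $n\le0$, $F_{k,1}=1$, and $F_{k,n}=\sum_{i=1}^kF_{k,n-i}$ for all $n\ge2$. *)

(* Defs.v *)
From mathcomp Require Import all_boot all_fingroup.

Set Implicit Arguments.
Unset Strict Implicit.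
Unset Printing Implicit Defensive.

(* Permutations of {1, ..., n} are elements of 'S_n, which acts on            *)
(* {0, ..., n-1}; the values are shifted back to {1, ..., n} here.            *)
Definition oneline n (s : 'S_n) : seq nat := [seq (s i).+1 | i <- enum 'I_n].

Definition same_order (u v : seq nat) : bool :=
  (size u == size v) &&
  [forall i : 'I_(size u), forall j : 'I_(size u),
     (nth 0 u i < nth 0 u j) == (nth 0 v i < nth 0 v j)].

(* The subsequences of w are the sequences mask m w (see subseqP); masks are  *)
(* used so that the quantifier ranges over a finite type.                     *)
Definition contains (w p : seq nat) : bool :=
  [exists m : (size w).-tuple bool, same_order (mask m w) p].

Lemma containsP (w p : seq nat) :
  reflect (exists2 u, subseq u w & same_order u p) (contains w p).
Proof.
apply: (iffP existsP) => [[m mP]|[u /subseqP[m szm ->] uP]].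
  by exists (mask m w) => //; apply: mask_subseq.
by exists (@Tuple _ _ m (introT eqP szm)).
Qed.

Definition avoids (w p : seq nat) : bool := ~~ contains w p.

Definition avoiding_involutions n (ps : seq (seq nat)) : {set 'S_n} :=
  [set s : 'S_n | [forall i, s (s i) == i] && all (avoids (oneline s)) ps].

Definition decreasing_pattern m : seq nat := rev (iota 1 m).

(* [:: F_{k,n}; ...; F_{k,1}; F_{k,0}]; taking the first k entries drops only *)
(* terms of nonpositive index, which vanish.                                  *)
Fixpoint gfibs (k n : nat) : seq nat :=
  match n with
  | 0 => [:: 0]
  | 1 => [:: 1; 0]
  | n'.+1 => let l := gfibs k n' in sumn (take k l) :: l
  end.

Definition gfib k n : nat := head 0 (gfibs k n).

Lemma gfib0 k : gfib k 0 = 0. Proof. by []. Qed.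

Lemma gfib1 k : gfib k 1 = 1. Proof. by []. Qed.

Lemma gfibsE k n : gfibs k n = [seq gfib k (n - i) | i <- iota 0 n.+1].
Proof.
elim: n => [//|n IHn]; rewrite -[iota _ _]/(0 :: iota (1 + 0) n.+1) map_cons subn0.
have -> : gfibs k n.+1 = gfib k n.+1 :: gfibs k n by case: n {IHn}.
by rewrite IHn iotaDl -map_comp; congr cons; apply: eq_map.
Qed.

(* n - i is truncated subtraction: the terms with n < i are F_{k,0} = 0.      *)
Lemma gfibE k n : 2 <= n -> gfib k n = \sum_(1 <= i < k.+1) gfib k (n - i).
Proof.
case: n => [//|[//|n]] _.
rewrite {1}/gfib [head _ _]/= -/(gfibs k n.+1) gfibsE -map_take take_iota.
rewrite sumnE big_map big_add1 -[minn _ _]subn0 -/(index_iota 0 _) /=.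
under [RHS]eq_bigr => i _ do rewrite subSS.
have [//|lt_k] := leqP k n.+2.
rewrite [RHS](@big_cat_nat _ _ _ n.+2) ?(ltnW lt_k) //=.
rewrite [X in _ = _ + X]big_nat_cond [X in _ = _ + X]big1 ?addn0 // => i.
case/andP=> /andP[ge_i _] _.
by have /eqP-> : n.+1 - i == 0 by rewrite subn_eq0 ltnW.
Qed.

(* Main.v *)
Require Import Defs.
From mathcomp Require Import all_boot all_fingroup.
From mathcomp Require Import zify.

(** An involution avoiding 3412 and 4231 is layered: it reverses each block of
    a division of {0, ..., n-1} into consecutive intervals.  To see this, look
    at its 2-cycles.  Two crossing cycles (a b), (c d) with a < c < b < d spell
    3412, so the cycles do not cross, and a cycle (a d) maps the interval
    between a and d to itself; an ascent strictly inside that interval would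
    complete 4231 together with a and d, so the whole interval is reversed.
    Applied to the cycle through 0 this splits off the first block, and
    induction does the rest (noncrossing_layered).

    Conversely, in a layered permutation the two ends of an inversion lie in one
    block, on which the permutation decreases (layered_inversion).  Both 3412
    and 4231 have an ascent strictly between, or at the end of, an inversion
    from their first to their last letter, so neither occurs; and a decreasing
    subsequence stays inside one block, so the longest one has the length of the
    largest block (layered_decreasing_size, layered_block).

    The permutations to be counted are therefore in bijection with the
    compositions of n into parts at most k + 1.  Sorting these by their first
    part gives the recurrence of the (k+1)-generalized Fibonacci numbers. *)

(** * Occurrences of patterns as sequences of positions *)

Lemma same_orderP (u v : seq nat) :
  reflect (size u = size v /\ forall i j, i < size u -> j < size u ->
             (nth 0 u i < nth 0 u j) = (nth 0 v i < nth 0 v j))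
          (same_order u v).
Proof.
apply: (iffP andP) => [[/eqP sz /forallP H]|[sz H]]; split => //.
- by move=> i j hi hj; have /forallP/(_ (Ordinal hj))/eqP := H (Ordinal hi).
- exact/eqP.
- by apply/forallP => i; apply/forallP => j; apply/eqP/H.
Qed.

Lemma subseq_iota_sorted (xs : seq nat) n :
  subseq xs (iota 0 n) = sorted ltn xs && all (gtn n) xs.
Proof.
apply/idP/andP => [sub|[srt /allP lt_n]].
  split; first exact: (subseq_sorted ltn_trans sub (iota_ltn_sorted 0 n)).
  by apply/allP => x /(mem_subseq sub); rewrite mem_iota.
rewrite (_ : xs = filter (mem xs) (iota 0 n)) ?filter_subseq //.
apply: (irr_sorted_eq ltn_trans ltnn) => //.
  exact: (sorted_filter ltn_trans _ (iota_ltn_sorted 0 n)).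
move=> x; rewrite mem_filter mem_iota /=.
by case xin: (x \in xs) => //=; have /= -> := lt_n _ xin.
Qed.

(** For the word of a function, an occurrence of a pattern becomes an increasing
    sequence of positions, at which the function can be reasoned about. *)
Lemma contains_word (f : nat -> nat) n p :
  contains [seq f i | i <- iota 0 n] p <->
  exists xs, [/\ sorted ltn xs, all (gtn n) xs & same_order (map f xs) p].
Proof.
split=> [/containsP[u /subseqP[m _ ->]]|[xs [srt lt_n so]]].
  rewrite -map_mask => so; exists (mask m (iota 0 n)); split=> //.
    by have := mask_subseq m (iota 0 n); rewrite subseq_iota_sorted => /andP[].
  by have := mask_subseq m (iota 0 n); rewrite subseq_iota_sorted => /andP[].
apply/containsP; exists (map f xs) => //.
by apply: map_subseq; rewrite subseq_iota_sorted srt.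
Qed.

Lemma size_decreasing_pattern m : size (decreasing_pattern m) = m.
Proof. by rewrite size_rev size_iota. Qed.

Lemma nth_decreasing_pattern m i : i < m -> nth 0 (decreasing_pattern m) i = m - i.
Proof.
by move=> lt_im; rewrite nth_rev ?size_iota // nth_iota; lia.
Qed.

(** * Layered permutations *)

(** The function reversing consecutive blocks whose sizes are the entries of
    [c].  It is defined on all of [nat], fixing what lies beyond the last block,
    so that inductions on [c] need no range conditions. *)
Fixpoint layered (c : seq nat) (i : nat) : nat :=
  if c is p :: c' then
    if i < p then p.-1 - i else p + layered c' (i - p)
  else i.

Lemma layered_lt c i : i < sumn c -> layered c i < sumn c.
Proof.
elim: c i => [//|p c IH] i /= lt_i; case: (ltnP i p) => [|le_pi]; first lia.
by have := IH (i - p); lia.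
Qed.

Lemma layeredK : forall c, involutive (layered c).
Proof.
elim=> [//|p c IH] i /=; case: (ltnP i p) => [lt_ip|le_pi].
  by case: ltnP; lia.
case: ltnP => [|_]; first lia.
by rewrite addKn IH; lia.
Qed.

(** Later blocks take larger values, so the ends of an inversion lie in one
    block; so does all that is between them, and a block is reversed. *)
Lemma layered_inversion c i j : i < j -> layered c j < layered c i ->
  forall a b, i <= a -> a < b -> b <= j -> layered c b < layered c a.
Proof.
elim: c i j => [|p c IH] i j /= lt_ij; first lia.
have [lt_jp|le_pj] := ltnP j p.
  by move=> _ a b *; case: (ltnP a p); case: (ltnP b p); lia.
case: (ltnP i p) => [lt_ip|le_pi]; first lia.
move=> inv a b *; rewrite !ltnNge !(leq_trans le_pi) //=; last lia.
have := IH (i - p) (j - p); rewrite -!ltnNge ltn_add2l; apply; lia.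
Qed.

(** A decreasing subsequence that starts in the first block never leaves it,
    since later blocks only take larger values. *)
Lemma layered_decreasing_size m c (xs : seq nat) : 0 < m -> all (geq m) c ->
  sorted ltn xs -> sorted gtn (map (layered c) xs) -> size xs <= m.
Proof.
move=> m_gt0; elim: c xs => [|p c IH] xs.
  by move=> _; case: xs => [//|x [//|y xs]] /= /andP[? _] /andP[? _]; lia.
case/andP=> /= le_pm le_cm; case: xs => [//|x xs] srt dec.
have gt_tail y : y \in xs -> x < y.
  by move: srt; rewrite /= (path_sortedE ltn_trans) => /andP[/allP + _] => /[apply].
have gtn_trans : transitive gtn by move=> a b d /=; lia.
have lt_tail y : y \in xs -> layered (p :: c) y < layered (p :: c) x.
  move: dec; rewrite [sorted _ _]/= (path_sortedE gtn_trans) => /andP[/allP H _] yin.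
  exact/H/map_f.
have [lt_xp|le_px] := ltnP x p.
  have below : {subset x :: xs <= iota 0 p}.
    move=> y; rewrite mem_iota inE => /orP[/eqP->//|yin].
    have := lt_tail _ yin; rewrite /= lt_xp; case: (ltnP y p); lia.
  have uniq_xs := sorted_uniq ltn_trans ltnn srt.
  by have := uniq_leq_size uniq_xs below; rewrite size_iota => /leq_trans; apply.
have above : {in x :: xs, forall y, p <= y}.
  by move=> y; rewrite inE => /orP[/eqP->//|/gt_tail]; lia.
have := IH [seq y - p | y <- x :: xs] le_cm; rewrite size_map; apply.
  rewrite sorted_map; apply: (sub_in_sorted (P := geq^~ p)) srt.
    by move=> a b; rewrite !unfold_in /=; lia.
  by apply/allP => y /above.
move: dec; rewrite -map_comp !sorted_map.
apply: (sub_in_sorted (P := geq^~ p)); last by apply/allP => y /above.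
by move=> a b; rewrite !unfold_in /=; case: (ltnP a p); case: (ltnP b p); lia.
Qed.

Lemma layered_block (c : seq nat) (p : nat) : p \in c -> exists2 o, o + p <= sumn c &
  forall i, i < p -> layered c (o + i) = o + (p.-1 - i).
Proof.
elim: c => [//|q c IH]; rewrite inE => /orP[/eqP->|/IH[o le_o Ho]].
  by exists 0 => /= [|i ->]; rewrite ?add0n //; lia.
exists (q + o) => /= [|i lt_ip]; first lia.
rewrite ifF; last lia.
rewrite (_ : q + o + i - q = o + i); last lia.
by rewrite Ho // addnA.
Qed.

(** The parts are read off the values: the first one from the value at 0. *)
Lemma layered_inj c d : all (ltn 0) c -> all (ltn 0) d -> sumn c = sumn d ->
  (forall i, i < sumn c -> layered c i = layered d i) -> c = d.
Proof.
elim: c d => [|p c IH] [|q d] //=; try lia.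
case/andP=> p0 c0 /andP[q0 d0] sum_eq eq_cd.
have eq_pq : p = q by have := eq_cd 0; rewrite p0 q0; lia.
subst q; congr cons; apply: IH => // [|i lt_i]; first lia.
have := eq_cd (p + i); rewrite (ltnNge _ p) leq_addr /= addKn.
by lia.
Qed.

(** * Noncrossing involutions are layered *)

(** With [p] arguments and only [p] values available, every step down is by
    exactly one. *)
Lemma strictly_decreasing_rev p (f : nat -> nat) : f 0 < p ->
  (forall i j, i < j -> j < p -> f j < f i) ->
  forall i, i < p -> f i = p.-1 - i.
Proof.
move=> f0 dec.
have upper i : i < p -> f i + i < p.
  elim: i => [|i IH] lt_ip; first lia.
  by have := dec i i.+1; lia.
have lower d : forall i, i + d.+1 = p -> d <= f i.
  elim: d => [//|d IH] i ?.
  by have := IH i.+1; have := dec i i.+1; lia.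
by move=> i lt_ip; have := upper i lt_ip; have := lower (p.-1 - i) i; lia.
Qed.

(** The first block is [0, f 0]: it is stable because cycles do not cross, and
    reversed because no ascent is nested in the cycle of 0.  The rest is a
    smaller instance of the statement, after shifting by the size of the
    block. *)
Lemma noncrossing_layered n (f : nat -> nat) :
  (forall i, i < n -> f i < n) -> (forall i, i < n -> f (f i) = i) ->
  (forall a b c d, a < b < c -> c < d < n -> ~ [/\ f c < f d, f d < f a & f a < f b]) ->
  (forall a b c d, a < b < c -> c < d < n -> ~ [/\ f d < f b, f b < f c & f c < f a]) ->
  exists c, [/\ all (ltn 0) c, sumn c = n & forall i, i < n -> f i = layered c i].
Proof.
elim/ltn_ind: n f => -[|n] IH f lt_f fK no3412 no4231; first by exists [::].
set p := (f 0).+1; have le_pn : p <= n.+1 by apply: lt_f.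
have ff0 := fK 0 isT.
have f_inj i j : i <= n -> j <= n -> f i = f j -> i = j.
  by move=> hi hj eq_f; rewrite -(fK i) // eq_f fK.
have f_block i : i < p -> f i < p.
  move=> lt_ip; rewrite ltnNge; apply/negP => ge_fi.
  have i_neq : i <> 0 /\ i <> f 0 by split=> eq_i; subst i; lia.
  (* The cycles (0, f 0) and (i, f i) would cross. *)
  have fi_n := lt_f i; have fKi := fK i.
  by apply: (no3412 0 i (f 0) (f i)); rewrite ?ff0 ?fKi //; try split; lia.
have dec i j : i < j -> j < p -> f j < f i.
  move=> lt_ij lt_jp; rewrite ltnNge; apply/negP => le_ff.
  have f_neq : f i <> f j by move=> /f_inj; lia.
  have [i0|i_gt0] := posnP i.
    by subst i; have := f_block j; lia.
  have fj_neq : f j <> f 0 by move=> /f_inj; lia.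
  have fi_neq0 : f i <> 0 by rewrite -ff0 => /f_inj; lia.
  have j_neq : j <> f 0 by move=> eq_j; move: le_ff; rewrite eq_j ff0; lia.
  have := f_block j lt_jp.
  (* The ascent at [i] and [j] is nested in the cycle (0, f 0). *)
  by move=> lt_fjp; apply: (no4231 0 i j (f 0)); rewrite ?ff0; try split; lia.
have f_rev := @strictly_decreasing_rev p f (ltnSn _) dec.
have f_above i : p <= i <= n -> p <= f i.
  move=> hi; rewrite leqNgt; apply/negP => /f_block.
  by rewrite fK; lia.
have [|i hi|i hi|a b c d h1 h2|a b c d h1 h2|c [c0 sum_c f_c]] :=
    IH (n.+1 - p) _ (fun i => f (p + i) - p); first lia.
- by have := lt_f (p + i); have := f_above (p + i); lia.
- by rewrite subnKC ?f_above ?fK; lia.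
- move=> [? ? ?].
  by apply: (no3412 (p + a) (p + b) (p + c) (p + d)); try split; lia.
- move=> [? ? ?].
  by apply: (no4231 (p + a) (p + b) (p + c) (p + d)); try split; lia.
exists (p :: c); split=> [||i lt_in]; rewrite ?[all _ _]/= ?c0 //=; first lia.
case: ltnP => [/f_rev//|le_pi].
have := f_c (i - p); rewrite subnKC // => <-; last lia.
by have := f_above i; lia.
Qed.

(** * Compositions with bounded parts *)

(** Each part consumes one unit of [fuel], so that [fuel >= n] suffices to reach
    all compositions. *)
Fixpoint compositions (m fuel n : nat) : seq (seq nat) :=
  if n == 0 then [:: [::]] else
  if fuel is fuel'.+1 then
    [seq p :: c | p <- iota 1 (minn m n), c <- compositions m fuel' (n - p)]
  else [::].

Lemma mem_compositions m fuel n (c : seq nat) : n <= fuel ->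
  (c \in compositions m fuel n) =
  [&& all (ltn 0) c, all (geq m) c & sumn c == n].
Proof.
have empty d : (d \in [:: [::]]) = [&& all (ltn 0) d, all (geq m) d & sumn d == 0].
  by rewrite inE; case: d => [//|[|p] d] //=; rewrite addSn !andbF.
elim: fuel n c => [|fuel IH] [|n] c // le_n; try exact: empty.
rewrite [compositions _ _ _]/=; apply/allpairsPdep/idP => [[p [d [p_in d_in ->]]]|].
  move: p_in d_in; rewrite mem_iota => p_in.
  rewrite IH /=; last lia.
  by case/and3P=> -> -> /eqP->; lia.
case: c => [//|p c] /= /and3P[/andP[p0 c0] /andP[pm cm] /eqP sum_c].
exists p, c; split=> //; first by rewrite mem_iota; lia.
by rewrite IH ?c0 ?cm /=; lia.
Qed.

Lemma uniq_compositions m fuel n : uniq (compositions m fuel n).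
Proof.
elim: fuel n => [|fuel IH] [|n] //.
apply: allpairs_uniq_dep; [exact: iota_uniq| by [] |].
by move=> [p c] [q d] _ _ [-> ->].
Qed.

(** Removing the first part gives the recurrence of the generalized Fibonacci
    numbers; its terms with first part larger than [n] vanish on both sides. *)
Lemma size_compositions m fuel n : n <= fuel ->
  size (compositions m fuel n) = gfib m n.+1.
Proof.
elim: fuel n => [|fuel IH] [|n] // le_n.
rewrite gfibE // size_allpairs_dep sumnE big_map.
have -> : iota 1 (minn m n.+1) = index_iota 1 (minn m n.+1).+1.
  by rewrite /index_iota subn1.
rewrite [RHS](@big_cat_nat _ _ _ (minn m n.+1).+1) //=; last lia.
rewrite [X in _ = _ + X]big_nat_cond [X in _ = _ + X]big1 ?addn0; last first.
  by move=> i hi; rewrite (_ : n.+2 - i = 0) ?gfib0; lia.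
rewrite big_nat_cond [RHS]big_nat_cond; apply: eq_bigr => i hi.
by rewrite IH; [congr gfib; lia | lia].
Qed.

(** * Passing between permutations and functions on the natural numbers *)

Definition perm_fun n (s : 'S_n) (i : nat) : nat :=
  if insub i is Some o then val (s o) else i.

Lemma perm_fun_ord n (s : 'S_n) (i : 'I_n) : perm_fun n s i = s i.
Proof. by rewrite /perm_fun valK. Qed.

Lemma oneline_perm_fun n (s : 'S_n) :
  oneline s = [seq (perm_fun n s i).+1 | i <- iota 0 n].
Proof.
rewrite -val_enum_ord -map_comp.
by apply: eq_map => i /=; rewrite perm_fun_ord.
Qed.

Definition layered_ord n c (i : 'I_n) : 'I_n := insubd i (layered c i).

(** A point that [layered c] would send out of the range is fixed instead; as
    [layered c] is an involution on [nat], it is not the image of another point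
    of the range. *)
Lemma layered_ordK n c : involutive (layered_ord n c).
Proof.
move=> i; apply: val_inj; rewrite /layered_ord !val_insubd.
case: (ltnP (layered c i) n) => [lt_n|ge_n]; first by rewrite layeredK ltn_ord.
by rewrite ltnNge ge_n.
Qed.

Definition layered_perm n c : 'S_n := perm (inv_inj (layered_ordK n c)).

Lemma perm_fun_layered n c i :
  sumn c = n -> i < n -> perm_fun n (layered_perm n c) i = layered c i.
Proof.
move=> sum_c lt_i; have lt_ci : layered c i < n by rewrite -sum_c layered_lt ?sum_c.
by rewrite -[i in LHS]/(val (Ordinal lt_i)) perm_fun_ord permE val_insubd lt_ci.
Qed.

(** * The avoiding involutions are the layered permutations *)

Section Avoiding.

Variables (n k : nat).

Let avoiding := avoiding_involutions n
  [:: [:: 3; 4; 1; 2]; [:: 4; 2; 3; 1]; decreasing_pattern (k + 2)].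

Lemma layered_perm_avoiding c : all (geq (k + 1)) c -> sumn c = n ->
  layered_perm n c \in avoiding.
Proof.
move=> c_le sum_c; rewrite inE; apply/andP; split.
  by apply/forallP => i; rewrite !permE layered_ordK.
have word : oneline (layered_perm n c) = [seq (layered c i).+1 | i <- iota 0 n].
  rewrite oneline_perm_fun; apply/eq_in_map => i.
  by rewrite mem_iota => lt_i; rewrite perm_fun_layered.
(* The first and last letters form an inversion, so the values would have to
   decrease all the way between their positions. *)
have no_ascent p i : size p = 4 -> i < 3 -> nth 0 p 3 < nth 0 p 0 ->
    nth 0 p i < nth 0 p i.+1 ->
    avoids [seq (layered c i).+1 | i <- iota 0 n] p.
  move=> sz_p lt_i inv asc; apply/negP.
  case/contains_word=> xs [srt _ /same_orderP[]].
  rewrite size_map sz_p => sz_xs so.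
  have nth_lt a b : a < b < 4 -> nth 0 xs a < nth 0 xs b.
    by move=> ?; apply: (sorted_ltn_nth ltn_trans) => //; rewrite ?inE; lia.
  have {}so a b : a < 4 -> b < 4 ->
      (layered c (nth 0 xs a) < layered c (nth 0 xs b)) = (nth 0 p a < nth 0 p b).
    by move=> ? ?; rewrite -so ?(nth_map 0) ?sz_xs.
  have le_nth a b : a <= b < 4 -> nth 0 xs a <= nth 0 xs b.
    by case: (ltngtP a b) => [? ?|//|-> //]; apply/ltnW/nth_lt; lia.
  have := @layered_inversion c (nth 0 xs 0) (nth 0 xs 3) (nth_lt _ _ _).
  rewrite so // => /(_ isT inv (nth 0 xs i) (nth 0 xs i.+1)).
  move/(_ (le_nth 0 i _) (nth_lt i i.+1 _) (le_nth i.+1 3 _)).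
  by rewrite so; lia.
rewrite /= word (no_ascent _ 2) // (no_ascent _ 1) //= andbT.
apply/negP => /contains_word[xs [srt _ /same_orderP[]]].
rewrite size_map size_decreasing_pattern => sz_xs so.
suff: size xs <= k + 1 by lia.
apply: (@layered_decreasing_size _ c) => //; first lia.
apply/(sortedP 0) => i; rewrite size_map => lt_i.
have := so i.+1 i; rewrite !(nth_map 0) ?nth_decreasing_pattern /=; lia.
Qed.

Lemma avoiding_layered_perm s : s \in avoiding -> exists c,
  [/\ all (ltn 0) c, all (geq (k + 1)) c, sumn c = n & s = layered_perm n c].
Proof.
rewrite inE => /andP[/forallP invol] /=.
rewrite oneline_perm_fun; set f := perm_fun n s.
case/and4P=> av1 av2 av3 _.
have f_lt i : i < n -> f i < n.
  by move=> lt_i; rewrite -[i]/(val (Ordinal lt_i)) /f perm_fun_ord.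
have fK i : i < n -> f (f i) = i.
  move=> lt_i; rewrite -[i]/(val (Ordinal lt_i)) /f !perm_fun_ord.
  by rewrite (eqP (invol _)).
have occurrence (x : 4.-tuple nat) p : sorted ltn x -> all (gtn n) x ->
    same_order [seq (f i).+1 | i <- x] p ->
    contains [seq (f i).+1 | i <- iota 0 n] p.
  by move=> *; apply/contains_word; exists x.
have [] := noncrossing_layered n f f_lt fK.
- move=> a b c d h1 h2 [h3 h4 h5]; case/negP: av1.
  apply: (occurrence [tuple a; b; c; d]) => /=; try lia.
  by apply/same_orderP; split=> // -[|[|[|[|i]]]] [|[|[|[|j]]]] //=; lia.
- move=> a b c d h1 h2 [h3 h4 h5]; case/negP: av2.
  apply: (occurrence [tuple a; b; c; d]) => /=; try lia.
  by apply/same_orderP; split=> // -[|[|[|[|i]]]] [|[|[|[|j]]]] //=; lia.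
move=> c [c_gt0 sum_c f_c]; exists c; split=> //.
  apply/allP => p p_in /=; rewrite leqNgt; apply/negP => gt_p.
  case/negP: av3; have [o le_o block] := layered_block _ _ p_in.
  apply/contains_word; exists (iota o (k + 2)); split.
  - exact: iota_ltn_sorted.
  - by apply/allP => i; rewrite mem_iota /=; lia.
  apply/same_orderP.
  rewrite size_map size_decreasing_pattern size_iota; split=> // i j hi hj.
  rewrite !(nth_map 0) ?size_iota // !nth_iota // !nth_decreasing_pattern //.
  by rewrite !f_c ?block; lia.
apply/permP => i; apply: val_inj; rewrite permE val_insubd.
by rewrite -f_c ?ltn_ord // /f perm_fun_ord ltn_ord.
Qed.

End Avoiding.

Theorem corollary7p3 (n k : nat) (hk : 1 <= k) :
  #|avoiding_involutions n
      [:: [:: 3; 4; 1; 2]; [:: 4; 2; 3; 1]; decreasing_pattern (k + 2)]|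
  = gfib (k + 1) (n + 1).
Proof.
rewrite (addn1 n) -(@size_compositions _ n) //.
have mem_comps c : c \in compositions (k + 1) n n ->
    [/\ all (ltn 0) c, all (geq (k + 1)) c & sumn c = n].
  by rewrite mem_compositions // => /and3P[? ? /eqP].
rewrite -(size_map (layered_perm n)).
have uniq_image : uniq [seq layered_perm n c | c <- compositions (k + 1) n n].
  rewrite map_inj_in_uniq ?uniq_compositions // => c d.
  case/mem_comps=> c0 _ sum_c /mem_comps[d0 _ sum_d] eq_cd.
  apply: layered_inj => // [|i lt_i]; first by rewrite sum_c.
  rewrite sum_c in lt_i.
  by rewrite -(perm_fun_layered _ _ _ sum_c) // eq_cd perm_fun_layered.
rewrite -(card_uniqP uniq_image); apply: eq_card => s.
apply/idP/mapP.
  case/avoiding_layered_perm=> c [c0 c_le sum_c ->].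
  by exists c; rewrite // mem_compositions // c0 c_le sum_c eqxx.
by case=> c /mem_comps[_ c_le sum_c] ->; apply: layered_perm_avoiding.
Qed.
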